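(* Let $G$ be a graph on $n$ vertices with adjacency matrix $M$ (an arbitrary real $n\times n$ matrix), and let $f$ be a perfect $k$-coloring of $G$ with parameter matrix $S$. Then for all $u,v\in V(G)$, $$d([M]^u,[M]^v)\ \ge\ d([S]^{f(u)},[S]^{f(v)}).$$
   Context: A graph $G$ on $n$ vertices, with vertex set $V(G)$, is identified with a real $n\times n$ matrix $M=(m_{u,v})_{u,v\in V(G)}$, called its adjacency matrix (so $G$ is a directed graph whose edges carry real labels $m_{u,v}$; no symmetry or $0/1$ assumption is made). A perfect $k$-coloring of $G$ with parameter matrix $S=(s_{i,j})$ (a real $k\times k$ matrix) is a partition of $V(G)$ into disjoint classes $J_1,\dots,J_k$ such that for all $i,j\in\{1,\dots,k\}$ and all $u\in J_i$ one has $s_{i,j}=\sum_{v\in J_j}m_{u,v}$. It is identified with the map $f:V(G)\to\{1,\dots,k\}$ with $f(v)=i$ if and only if $v\in J_i$. For a square matrix $A$, $[A]^i$ denotes its $i$-th row. For real tuples $x=(x_1,\dots,x_N)$, $y=(y_1,\dots,y_N)$, $d(x,y)=\sum_{i=1}^N|x_i-y_i|$ is the $L_1$ distance. *)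

(* Defs.v *)
From mathcomp Require Import all_boot all_order all_algebra.
From mathcomp Require Import reals.

Set Implicit Arguments.
Unset Strict Implicit.
Unset Printing Implicit Defensive.

Import Order.TTheory GRing.Theory Num.Theory.

Local Open Scope ring_scope.

(* A graph on n vertices is its adjacency matrix M : 'M[R]_n, with vertex set
   'I_n; M u v is the label of the edge from u to v. *)

Definition color_class (n k : nat) (f : 'I_n -> 'I_k) (i : 'I_k) : {set 'I_n} :=
  [set v | f v == i].

(* The classes are indexed by the colors and some of them may be empty:
   surjectivity of f is not required. *)
Definition perfect_coloring (R : realType) (n k : nat)
    (M : 'M[R]_n) (S : 'M[R]_k) (f : 'I_n -> 'I_k) : Prop :=
  forall (i j : 'I_k) (u : 'I_n), u \in color_class f i ->
    S i j = \sum_(v in color_class f j) M u v.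

Definition l1_dist (R : realType) (N : nat) (x y : 'rV[R]_N) : R :=
  \sum_(i < N) `|x 0 i - y 0 i|.

(* Main.v *)
Require Import Defs.
From mathcomp Require Import all_boot all_order all_algebra.
From mathcomp Require Import reals.

Import Order.TTheory GRing.Theory Num.Theory.

Local Open Scope ring_scope.

(** The color classes partition the columns of [M], and entry [j] of row [f u] of [S] is the sum of
    row [u] of [M] over class [j]. Merging the columns of a class can only shrink the L1 distance,
    by the triangle inequality in each class. *)

Theorem theorem1 (R : realType) (n k : nat) (M : 'M[R]_n) (S : 'M[R]_k)
    (f : 'I_n -> 'I_k) (hf : perfect_coloring M S f) (u v : 'I_n) :
  l1_dist (row u M) (row v M) >= l1_dist (row (f u) S) (row (f v) S).
Proof.
rewrite /l1_dist (partition_big f xpredT) //=.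
apply: ler_sum => j _.
rewrite !mxE (hf _ j u) ?inE // (hf _ j v) ?inE // -sumrB.
apply: le_trans (ler_norm_sum _ _ _) _.
(* Both sides are now the same sum, since [w \in color_class f j] means [f w == j]. *)
rewrite le_eqVlt; apply/orP; left; apply/eqP.
by apply: eq_big => [w | w _]; rewrite ?inE ?mxE.
Qed.
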